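(* Let $\mathcal{A}$ be a finite alphabet and let $\Theta:\mathcal{A}^*\to\mathcal{A}^*$ be an involutive antimorphism. Let $\mathbf{u}\in\mathcal{A}^{\mathbb{N}}$ be a uniformly recurrent infinite word such that $D_{\Theta}(\mathbf{u})<+\infty$. Then there exist a finite alphabet $\mathcal{B}$, a morphism $\varphi:\mathcal{B}^*\to\mathcal{A}^*$ and a uniformly recurrent infinite word $\mathbf{v}\in\mathcal{B}^{\mathbb{N}}$ such that $\mathbf{u}=\varphi(\mathbf{v})$ and $\mathbf{v}$ is $\Theta_0$-rich, where $\Theta_0$ denotes the reversal mapping on $\mathcal{B}^*$.
   Context: An involutive antimorphism on $\mathcal{A}^*$ is a map $\Theta:\mathcal{A}^*\to\mathcal{A}^*$ with $\Theta^2=\mathrm{Id}$ and $\Theta(uv)=\Theta(v)\Theta(u)$ for all $u,v$. The reversal mapping $\Theta_0$ sends $w_1w_2\cdots w_n$ to $w_nw_{n-1}\cdots w_1$. A word $w$ is a $\Theta$-palindrome if $\Theta(w)=w$ (the empty word is one). For a finite word $w$, $\mathrm{Pal}_\Theta(w)$ is the set of distinct $\Theta$-palindromes occurring as factors of $w$ (including the empty word), and $G_\Theta(w)$ is the number of sets $\{a,\Theta(a)\}$ where $a$ is a letter occurring in $w$ with $a\neq\Theta(a)$. The $\Theta$-palindromic defect of a finite word $w$ is $D_\Theta(w)=|w|+1-G_\Theta(w)-\#\mathrm{Pal}_\Theta(w)$, and for an infinite word $\mathbf{u}$, $D_\Theta(\mathbf{u})=\sup\{D_\Theta(w): w \text{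 a factor of } \mathbf{u}\}$. A finite word $w$ is $\Theta$-rich if $D_\Theta(w)=0$; an infinite word is $\Theta$-rich if all its factors are $\Theta$-rich (for $\Theta_0$ this is the usual notion of a rich word: each factor $w$ contains $|w|+1$ distinct palindromes). An infinite word is recurrent if every factor occurs infinitely often; it is uniformly recurrent if it is recurrent and every factor $w$ has only finitely many return words, i.e. finitely many factors $q$ such that $qw$ has $w$ as prefix and suffix and contains exactly two occurrences of $w$. *)

(* Defs.v *)
From HB Require Import structures.
From mathcomp Require Import all_boot all_order all_algebra.
From mathcomp Require Import finmap.
Set Implicit Arguments. Unset Strict Implicit. Unset Printing Implicit Defensive.
Import GRing.Theory Num.Theory.

Section Words.
Variable A : choiceType.

Definition involutive_antimorphism (Th : seq A -> seq A) : Prop :=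
  (forall w, Th (Th w) = w) /\ (forall x y, Th (x ++ y) = Th y ++ Th x).

Definition factors (w : seq A) : seq (seq A) :=
  [seq take j (drop i w) | i <- iota 0 (size w).+1, j <- iota 0 (size w - i).+1].

Definition nPal (Th : seq A -> seq A) (w : seq A) : nat :=
  size (undup [seq x <- factors w | Th x == x]).

Definition G_Th (Th : seq A -> seq A) (w : seq A) : nat :=
  size (undup [seq [fset [:: a]; Th [:: a]]%fset | a : A <- w & Th [:: a] != [:: a]]).

Definition defect (Th : seq A -> seq A) (w : seq A) : int :=
  ((size w).+1)%:Z - (G_Th Th w)%:Z - (nPal Th w)%:Z.

Definition rich (Th : seq A -> seq A) (w : seq A) : Prop := defect Th w = 0%R.

Definition factor_at (u : nat -> A) (i n : nat) : seq A := mkseq (fun k => u (i + k)) n.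

Definition is_factor (u : nat -> A) (w : seq A) : Prop :=
  exists i, factor_at u i (size w) = w.

Definition finite_defect (Th : seq A -> seq A) (u : nat -> A) : Prop :=
  exists D : int, forall i n, (defect Th (factor_at u i n) <= D)%R.

Definition rich_inf (Th : seq A -> seq A) (u : nat -> A) : Prop :=
  forall i n, rich Th (factor_at u i n).

Definition count_occ (w x : seq A) : nat :=
  count (fun i => take (size w) (drop i x) == w) (iota 0 (size x - size w).+1).

Definition return_word (u : nat -> A) (w q : seq A) : Prop :=
  is_factor u (q ++ w) /\ prefix w (q ++ w) /\ suffix w (q ++ w)
  /\ count_occ w (q ++ w) = 2.

Definition recurrent (u : nat -> A) : Prop :=
  forall i n N, exists j, N <= j /\ factor_at u j n = factor_at u i n.

Definition uniformly_recurrent (u : nat -> A) : Prop :=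
  recurrent u /\
  forall w, is_factor u w ->
    exists s : seq (seq A), forall q, return_word u w q -> q \in s.

End Words.

(* Image of an infinite word under a morphism phi : B^* -> A^* (given by
   its values on letters): u = phi(v). *)
Definition morph_word {B A : eqType} (phi : B -> seq A) (w : seq B) : seq A :=
  flatten (map phi w).

Definition morph_image {B A : eqType} (phi : B -> seq A) (v : nat -> B) (u : nat -> A) : Prop :=
  (forall m, morph_word phi (mkseq v m) =
             mkseq u (size (morph_word phi (mkseq v m)))) /\
  (forall n, exists m, n <= size (morph_word phi (mkseq v m))).

(* Main.v *)
(* A long palindrome of a word of finite defect behaves as in a rich word: once a
   factor contains a factor of maximal defect, extending it creates a new
   palindrome at each letter, and therefore every complete return to {z, Theta z}
   is a Theta-palindrome as soon as z is long enough. Extend u to the left by n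
   letters within its language and let z be the prefix of length 2n of the
   resulting word U. Cutting U at the centres of the occurrences of z and
   Theta z cuts u from its very beginning, and the complete returns, taken as
   letters, form a word v. Since these letters are Theta-palindromes, palindromes
   of v correspond to Theta-palindromes of U delimited by such occurrences, and
   the return property of U makes v rich. *)
Require Import Defs.
From mathcomp Require Import all_boot all_order all_algebra.
From mathcomp Require Import finmap.
From mathcomp Require Import zify.
From Stdlib Require Import Classical.

Set Implicit Arguments.
Unset Strict Implicit.
Unset Printing Implicit Defensive.

(** * Antimorphisms and infixes of finite words *)

Section FiniteWords.
Variables (A : choiceType) (Th : seq A -> seq A).
Hypothesis ThP : involutive_antimorphism Th.
Implicit Types (w p q x y z : seq A) (a b : A).

(* [infixP] and its variants produce words over the underlying eqType, which
   [lia] does not identify with words over [A]. *)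
Lemma infix_catP x w : infix x w -> exists s t : seq A, w = s ++ x ++ t.
Proof. by move/infixP. Qed.

Lemma suffix_catP x w : suffix x w -> exists s : seq A, w = s ++ x.
Proof. by move/suffixP. Qed.

Lemma ThK : cancel Th Th.
Proof. by case: ThP. Qed.

Lemma Th_cat x y : Th (x ++ y) = Th y ++ Th x.
Proof. by case: ThP. Qed.

Lemma Th_inj : injective Th.
Proof. exact: (can_inj ThK). Qed.

Lemma Th_nil : Th [::] = [::].
Proof.
have := congr1 size (Th_cat [::] [::]); rewrite cats0 size_cat => h.
by apply: size0nil; lia.
Qed.

(** Being injective with [Th [::] = [::]], [Th] erases no letter; applied to [w] and [Th w], this
    makes [Th] length-preserving. *)
Lemma leq_size_Th w : size w <= size (Th w).
Proof.
elim: w => [|a w IH] //.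
rewrite -cat1s Th_cat !size_cat /=.
have : size (Th [:: a]) != 0; last by lia.
by apply/eqP=> /size0nil h; have := ThK [:: a]; rewrite h Th_nil.
Qed.

Lemma size_Th w : size (Th w) = size w.
Proof. by have := leq_size_Th w; have := leq_size_Th (Th w); rewrite ThK; lia. Qed.

Lemma infix_Th x w : infix x w -> infix (Th x) (Th w).
Proof.
by case/infix_catP=> s [t ->]; rewrite !Th_cat -catA; apply: infix_infix.
Qed.

Lemma infix_ThE x w : infix (Th x) w = infix x (Th w).
Proof.
by apply/idP/idP=> /infix_Th; rewrite ThK.
Qed.

Lemma suffix_suffix_leq w x y :
  suffix x w -> suffix y w -> size x <= size y -> suffix x y.
Proof.
case/suffix_catP=> t Et /suffix_catP[s Es] le_xy.
have := congr1 size Es; rewrite Et !size_cat => h.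
rewrite -(drop_size_cat y (erefl (size s))) -Es Et.
rewrite drop_cat; case: ltnP => _; first exact: suffix_suffix.
by rewrite (_ : size s - size t = 0) ?drop0 ?suffix_refl //; lia.
Qed.

Lemma mem_factors x w : (x \in factors w) = infix x w.
Proof.
apply/allpairsPdep/idP => [[i [j [_ _ ->]]]|/infix_catP[s [t ->]]].
  exact: infix_trans (infix_take _ _) (infix_drop _ _).
exists (size s), (size x); rewrite drop_size_cat // take_size_cat //.
by rewrite !mem_iota !size_cat; split=> //; lia.
Qed.

(** * Palindromes gained by appending a letter *)

Definition pals w := undup [seq x <- factors w | Th x == x].

Lemma mem_pals x w : (x \in pals w) = (Th x == x) && infix x w.
Proof. by rewrite mem_undup mem_filter mem_factors. Qed.

Lemma pals_Th w : pals (Th w) =i pals w.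
Proof.
move=> x; rewrite !mem_pals -infix_ThE.
by case: eqP => //= ->.
Qed.

Lemma nPal_Th w : nPal Th (Th w) = nPal Th w.
Proof.
apply/perm_size/uniq_perm; rewrite ?undup_uniq //; exact: pals_Th.
Qed.

(** Both words are suffixes of [rcons w a], so [x] is a suffix of [y] and, by mirroring, a prefix of
    [y]. Were it a proper prefix, it would already occur in [w]. Hence a letter creates at most one
    new palindrome. *)
Lemma new_pal_leq w a x y :
  Th x = x -> infix x (rcons w a) -> ~~ infix x w ->
  Th y = y -> infix y (rcons w a) -> ~~ infix y w ->
  size x <= size y -> x = y.
Proof.
move=> xP; rewrite infix_rconsl => /orP[sx nx|-> //].
move=> yP; rewrite infix_rconsl => /orP[sy _ le_xy|-> //].
have /suffix_catP[r Ey] := suffix_suffix_leq sx sy le_xy.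
case/suffix_catP: sy => s Es; have : y = x ++ Th r by rewrite -yP Ey Th_cat xP.
case/lastP: (Th r) => [|r' b E]; first by rewrite cats0.
move: Es; rewrite E -rcons_cat -rcons_cat => /rcons_inj[Ew _].
by case/negP: nx; rewrite Ew infix_infix.
Qed.

Lemma nPal_rcons_le w a : nPal Th (rcons w a) <= (nPal Th w).+1.
Proof.
case: (boolP (has [pred x | x \notin pals w] (pals (rcons w a)))).
  case/hasP=> x; rewrite mem_pals /= mem_pals => /andP[/eqP xP ix].
  rewrite xP eqxx /= => nx.
  apply: (@uniq_leq_size _ _ (x :: pals w)); first exact: undup_uniq.
  move=> y; rewrite -/(pals _) mem_pals inE => /andP[/eqP yP iy].
  rewrite mem_pals yP eqxx /=; case: (boolP (infix y w)) => ny; first by rewrite orbT.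
  rewrite orbF; apply/eqP; case: (leqP (size x) (size y)) => [|/ltnW] le.
    by symmetry; apply: (@new_pal_leq w a).
  exact: (@new_pal_leq w a).
rewrite has_predC negbK => /allP h.
by apply/leqW/uniq_leq_size; [exact: undup_uniq | exact: h].
Qed.

Lemma nPal_rcons_new w a x :
  Th x = x -> infix x (rcons w a) -> ~~ infix x w ->
  nPal Th w < nPal Th (rcons w a).
Proof.
move=> xP ix nx; apply: (@uniq_leq_size _ (x :: pals w)).
  by rewrite /= undup_uniq mem_pals xP eqxx nx.
move=> y; rewrite inE -/(pals _) => /orP[/eqP->|]; rewrite !mem_pals ?xP ?eqxx //.
case/andP=> -> /infix_trans; apply; exact: infix_rcons.
Qed.

Lemma nPal_rcons_old w a :
  (forall x, Th x = x -> infix x (rcons w a) -> infix x w) ->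
  nPal Th (rcons w a) <= nPal Th w.
Proof.
move=> h; apply: uniq_leq_size (undup_uniq _) _ => x.
rewrite -/(pals _) -/(pals _) !mem_pals => /andP[/eqP xP ix].
by rewrite xP eqxx h.
Qed.

(** * Pairs of letters exchanged by the antimorphism *)

Definition gpair a := [fset [:: a]; Th [:: a]]%fset.

Definition gpairs w := undup [seq gpair a | a <- w & Th [:: a] != [:: a]].

Lemma mem_gpairs w a :
  Th [:: a] != [:: a] -> a \in w -> gpair a \in gpairs w.
Proof.
by move=> na aw; rewrite mem_undup; apply: map_f; rewrite mem_filter na.
Qed.

Lemma gpairsP w X :
  reflect (exists a, [/\ Th [:: a] != [:: a], a \in w & X = gpair a])
          (X \in gpairs w).
Proof.
rewrite mem_undup; apply: (iffP mapP) => [[a]|[a [na aw ->]]].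
  by rewrite mem_filter => /andP[na aw ->]; exists a.
by exists a; rewrite // mem_filter na.
Qed.

Lemma Th_letter a : exists b, Th [:: a] = [:: b].
Proof.
by have := size_Th [:: a]; case: (Th _) => // b [|] // _; exists b.
Qed.

Lemma gpair_Th a b : Th [:: a] = [:: b] -> gpair a = gpair b.
Proof.
move=> h; have hb : Th [:: b] = [:: a] by rewrite -h ThK.
by rewrite /gpair h hb; apply/fsetP=> x; rewrite !inE orbC.
Qed.

Lemma sub_gpairs_Th w : {subset gpairs w <= gpairs (Th w)}.
Proof.
move=> X /gpairsP[a [na aw ->]]; have [b h] := Th_letter a.
rewrite (gpair_Th h); apply: mem_gpairs.
  by rewrite -h ThK eq_sym.
by rewrite -infix1s -h infix_ThE ThK infix1s.
Qed.

Lemma G_Th_Th w : G_Th Th (Th w) = G_Th Th w.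
Proof.
apply/eqP; rewrite eqn_leq; apply/andP; split; apply: uniq_leq_size;
  rewrite ?undup_uniq //; last exact: sub_gpairs_Th.
by rewrite -{2}[w]ThK; apply: sub_gpairs_Th.
Qed.

Lemma G_Th_rcons_le w a : G_Th Th (rcons w a) <= (G_Th Th w).+1.
Proof.
apply: (@uniq_leq_size _ _ (gpair a :: gpairs w)); first exact: undup_uniq.
move=> X /gpairsP[b [nb]]; rewrite mem_rcons !inE => /orP[/eqP-> ->|bw ->].
  by rewrite eqxx.
by rewrite (mem_gpairs nb bw) orbT.
Qed.

(** A letter and its image give the same pair, so an earlier occurrence of either one has already
    counted it. *)
Lemma G_Th_rcons_old w a :
  [|| Th [:: a] == [:: a], infix [:: a] w | infix (Th [:: a]) w] ->
  G_Th Th (rcons w a) <= G_Th Th w.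
Proof.
move=> h; apply: uniq_leq_size (undup_uniq _) _ => X.
case/gpairsP=> b [nb]; rewrite mem_rcons inE => /orP[/eqP E ->|bw ->]; last first.
  exact: mem_gpairs.
move: E nb => -> na; move: h; rewrite (negPf na) infix1s /= => /orP[|]; first exact: mem_gpairs.
have [c h] := Th_letter a; rewrite h infix1s (gpair_Th h); apply: mem_gpairs.
by rewrite -h ThK eq_sym.
Qed.

(** * Monotonicity of the defect and palindromic complete returns *)

Lemma defect_Th w : defect Th (Th w) = defect Th w.
Proof. by rewrite /defect size_Th G_Th_Th nPal_Th. Qed.

(* A new palindrome longer than one letter ends in [a] and starts in [Th a],
   so a letter and a palindrome cannot both be new. *)
Lemma defect_rcons w a : (defect Th w <= defect Th (rcons w a))%R.
Proof.
rewrite /defect size_rcons.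
have hP := nPal_rcons_le w a; have hG := G_Th_rcons_le w a.
case: (boolP [|| Th [:: a] == [:: a], infix [:: a] w | infix (Th [:: a]) w]).
  by move=> /G_Th_rcons_old; lia.
rewrite !negb_or => /and3P[na nw nTw].
suff : nPal Th (rcons w a) <= nPal Th w by lia.
apply: nPal_rcons_old => x xP; rewrite infix_rconsl => /orP[|//].
case/lastP: x xP => [_ _|x b]; first exact: infix0s.
rewrite suffix_rcons => + /andP[/eqP Eb sx]; rewrite {b}Eb.
rewrite -cats1 Th_cat; have [c h] := Th_letter a; rewrite h => E.
case: x E sx => [|d x] /=; first by case: (Th [::]) => [[]|//] E; rewrite h E eqxx in na.
case=> <- _ /suffixW/mem_infix/(_ c); rewrite inE eqxx => /(_ isT) cw.
by rewrite h infix1s cw in nTw.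
Qed.

Lemma defect_catr w x : (defect Th w <= defect Th (w ++ x))%R.
Proof.
elim/last_ind: x => [|x a IH]; first by rewrite cats0.
by rewrite -rcons_cat; have := defect_rcons (w ++ x) a; lia.
Qed.

(** [Th] preserves the defect and turns left extensions into right ones, so right extensions
    suffice. *)
Lemma defect_infix x w : infix x w -> (defect Th x <= defect Th w)%R.
Proof.
case/infix_catP=> s [t ->].
have := defect_catr (Th (x ++ t)) (Th s); rewrite -Th_cat !defect_Th.
by have := defect_catr x t; lia.
Qed.

(** The length grows by one and no pair is added; without a new palindrome the defect would rise. *)
Lemma new_pal_of_defect w a :
  infix [:: a] w || infix (Th [:: a]) w ->
  (defect Th (rcons w a) <= defect Th w)%R ->
  exists x, [/\ Th x = x, infix x (rcons w a) & ~~ infix x w].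
Proof.
move=> aw le; apply: NNPP => h; move: le.
have : G_Th Th (rcons w a) <= G_Th Th w.
  by apply: G_Th_rcons_old; rewrite aw orbT.
have : nPal Th (rcons w a) <= nPal Th w.
  apply: nPal_rcons_old => x xP ix; case: (boolP (infix x w)) => // nx.
  by case: h; exists x.
by rewrite /defect size_rcons; lia.
Qed.

(* The last letter of [q] does not raise the defect, so it completes a
   palindrome occurring only once in [q]. This palindrome cannot fit in the final
   [z] or [Th z], which has a copy or mirror image in the initial [z]; hence it
   strictly contains it and starts with its mirror image, which by [noq] is the
   initial occurrence. *)
Lemma complete_return_pal q z :
  0 < size z < size q -> prefix z q -> suffix z q || suffix (Th z) q ->
  (forall s x t, (x == z) || (x == Th z) -> q = s ++ x ++ t -> s = [::] \/ t = [::]) ->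
  (defect Th q <= defect Th z)%R -> Th q = q.
Proof.
case/lastP: q => [|p a]; first by rewrite ltn0 andbF.
rewrite size_rcons ltnS => /andP[z0 le_zp] zq z2q noq le_d.
have zp : infix z p.
  apply: prefixW; move: zq; rewrite !prefixE -cats1 take_cat.
  by move: le_zp; rewrite leq_eqVlt => /orP[/eqP->|->//]; rewrite ltnn subnn take0 cats0 take_size.
have [z2 z2P sz2] : exists2 z2 : seq A, (z2 == z) || (z2 == Th z) & suffix z2 (rcons p a).
  by case/orP: z2q; [exists z | exists (Th z)]; rewrite ?eqxx ?orbT.
have size_z2 : size z2 = size z by case/orP: z2P => /eqP->; rewrite ?size_Th.
have infix_z2 x : infix x z2 -> infix x z || infix (Th x) z.
  by case/orP: z2P => /eqP->; rewrite ?infix_ThE => ->; rewrite ?orbT.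
have az : infix [:: a] p || infix (Th [:: a]) p.
  have /infix_z2 : infix [:: a] z2.
    case/lastP: z2 sz2 size_z2 {z2P infix_z2} => [|z2 b]; first by move=> _ /= h; rewrite -h in z0.
    by rewrite suffix_rcons infix1s mem_rcons inE eq_sym => /andP[-> _].
  by case/orP=> /infix_trans/(_ zp)->; rewrite ?orbT.
have le_dp : (defect Th (rcons p a) <= defect Th p)%R.
  by have := defect_infix zp; lia.
have [x [xP ix nx]] := new_pal_of_defect az le_dp.
have sx : suffix x (rcons p a) by move: ix nx; rewrite infix_rconsl => /orP[//|->].
case: (leqP (size x) (size z)) => [le_xz|lt_zx].
  have /suffixW/infix_z2 : suffix x z2 by apply: suffix_suffix_leq sx sz2 _; lia.
  by rewrite xP orbb => /infix_trans/(_ zp) h; rewrite h in nx.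
have /suffix_catP[r Ex] : suffix z2 x by apply: suffix_suffix_leq sz2 sx _; lia.
case/suffix_catP: sx => s Eq.
have Ex2 : x = Th z2 ++ Th r by rewrite -xP {1}Ex Th_cat.
have /noq : (Th z2 == z) || (Th z2 == Th z).
  by case/orP: z2P => /eqP->; rewrite ?ThK eqxx ?orbT.
case/(_ s (Th r)); first by rewrite -Ex2.
  by move=> s0; rewrite Eq s0 /= xP.
move/(congr1 size); rewrite size_Th /= => r0.
by move: lt_zx; rewrite Ex size_cat; lia.
Qed.

End FiniteWords.

(** * Factors of infinite words and uniform recurrence *)

Section InfiniteWords.
Variable A : choiceType.
Implicit Types (u v : nat -> A) (i j n : nat).

Lemma size_factor_at u i n : size (factor_at u i n) = n.
Proof. exact: size_mkseq. Qed.

Lemma factor_at_cat u i n k :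
  factor_at u i (n + k) = factor_at u i n ++ factor_at u (i + n) k.
Proof.
rewrite /factor_at /mkseq iotaD map_cat; congr (_ ++ _).
rewrite add0n -[n in iota n]addn0 iotaDl -map_comp.
by apply: eq_map => d /=; rewrite addnA.
Qed.

Lemma factor_at_rcons u i n :
  factor_at u i n.+1 = rcons (factor_at u i n) (u (i + n)).
Proof. exact: mkseqS. Qed.

Lemma factor_atP u v i j n :
  factor_at u i n = factor_at v j n <->
  (forall d, d < n -> u (i + d) = v (j + d)).
Proof.
split=> [E d dn|E].
  by have := congr1 (fun s => nth (u (i + d)) s d) E; rewrite !nth_mkseq.
by apply/eq_in_map=> d; rewrite mem_iota => /E.
Qed.

Lemma sub_factor_at u v i j n d k :
  factor_at u i n = factor_at v j n -> d + k <= n ->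
  factor_at u (i + d) k = factor_at v (j + d) k.
Proof.
move=> /factor_atP E le; apply/factor_atP=> e lt; rewrite -!addnA.
by apply: E; lia.
Qed.

Lemma factor_at_split u i n d k : d + k <= n ->
  factor_at u i n =
  factor_at u i d ++ factor_at u (i + d) k ++ factor_at u (i + d + k) (n - d - k).
Proof. by move=> le; rewrite -!factor_at_cat; congr factor_at; lia. Qed.

Lemma infix_factor_at u i n d k :
  d + k <= n -> infix (factor_at u (i + d) k) (factor_at u i n).
Proof. by move=> le; rewrite (factor_at_split u i le) infix_infix. Qed.

Lemma infix_factor_atP u i n (x : seq A) : infix x (factor_at u i n) ->
  exists2 d, d + size x <= n & factor_at u (i + d) (size x) = x.
Proof.
case/infix_catP=> s [t E]; exists (size s).
  by have := congr1 size E; rewrite size_factor_at !size_cat; lia.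
have le : size s + size x <= n.
  by have := congr1 size E; rewrite size_factor_at !size_cat; lia.
move/eqP: E; rewrite (factor_at_split u i le) eqseq_cat ?size_factor_at //.
by rewrite eqseq_cat ?size_factor_at // => /and3P[_ /eqP].
Qed.

(** [Th] reverses the order of the three pieces around the slice; pieces of equal length are then
    compared. *)
Lemma pal_slice (Th : seq A -> seq A) u i n d k :
  involutive_antimorphism Th -> Th (factor_at u i n) = factor_at u i n ->
  d + k <= n ->
  Th (factor_at u (i + d) k) = factor_at u (i + (n - d - k)) k.
Proof.
move=> ThP E le; move: E; rewrite {1}(factor_at_split u i le).
have le' : (n - d - k) + k <= n by lia.
rewrite (factor_at_split u i le') !(Th_cat ThP) -catA => /eqP.
rewrite eqseq_cat ?(size_Th ThP) ?size_factor_at //.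
by rewrite eqseq_cat ?(size_Th ThP) ?size_factor_at // => /and3P[_ /eqP].
Qed.

(** Over a finite alphabet this amounts to uniform recurrence; this form passes easily to left
    extensions and to codings. *)
Definition bounded_gaps u := forall i n, exists K, forall j,
  exists2 t, j <= t < j + K & factor_at u t n = factor_at u i n.

Lemma count_occ_factor_at u j d n :
  count_occ (factor_at u (j + d) n) (factor_at u j (d + n)) =
  count (fun t => factor_at u (j + t) n == factor_at u (j + d) n) (iota 0 d.+1).
Proof.
rewrite /count_occ !size_factor_at addnK; apply: eq_in_count => t.
rewrite mem_iota => lt_td; have le : t + n <= d + n by lia.
by rewrite (factor_at_split u j le) drop_size_cat ?take_size_cat ?size_factor_at.
Qed.

(** The last occurrence before [j] and the first one from [j] on delimit a return word, and return
    words have bounded length. *)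
Lemma bounded_gaps_of_uniformly_recurrent u :
  uniformly_recurrent u -> bounded_gaps u.
Proof.
case=> rec ret i n; set w := factor_at u i n.
have [s sP] : exists s : seq (seq A), forall q, return_word u w q -> q \in s.
  by apply: ret; exists i; rewrite size_factor_at.
(* The summand [i] serves the windows with [j <= i], which may have no occurrence to their left. *)
pose M := \max_(q <- s) size q; exists (i + M).+1 => j.
case: (leqP j i) => [le_ji|lt_ij]; first by exists i; rewrite // le_ji; lia.
have exL : exists t, (t < j) && (factor_at u t n == w) by exists i; rewrite lt_ij eqxx.
have exR : exists t, (j <= t) && (factor_at u t n == w).
  by have [t [le_jt Et]] := rec i n j; exists t; rewrite le_jt Et eqxx.
have ubL t : (t < j) && (factor_at u t n == w) -> t <= j by lia.
case: (ex_maxnP exL ubL) => l /andP[lt_lj /eqP El] maxl.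
case: (ex_minnP exR) => r /andP[le_jr /eqP Er] minr.
exists r => //; have Erl : l + (r - l) = r by lia.
suff /sP/(@leq_bigmax_seq _ s xpredT size)/(_ isT) : return_word u w (factor_at u l (r - l)).
  by rewrite -/M size_factor_at; lia.
have Ew : w = factor_at u (l + (r - l)) n by rewrite Erl Er.
have Eq : factor_at u l (r - l) ++ w = factor_at u l (r - l + n).
  by rewrite factor_at_cat Erl Er.
rewrite /return_word Eq; split; first by exists l; rewrite size_factor_at.
split; first by rewrite addnC factor_at_cat El prefix_prefix.
split; first by rewrite -Eq suffix_suffix.
rewrite [in count_occ _]Ew count_occ_factor_at -Ew.
(* The first and last positions count; one strictly between would contradict the maximality of [l]
   or the minimality of [r]. *)
have [e Ee] : exists e, r - l = e.+1 by exists (r - l).-1; lia.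
rewrite Ee -addn1 iotaD count_cat /= add0n addn0 -/w El eqxx /= -Ee Erl Er eqxx.
rewrite (@eq_in_count _ _ pred0) ?count_pred0 // => t.
rewrite mem_iota /= => lt_te; apply/negbTE/negP=> Et.
case: (ltnP (l + t) j) => h.
  by have := maxl (l + t); rewrite h Et => /(_ isT); lia.
by have := minr (l + t); rewrite h Et => /(_ isT); lia.
Qed.

Lemma return_word_bounded u i n K q :
  (forall j, exists2 t, j <= t < j + K & factor_at u t n = factor_at u i n) ->
  return_word u (factor_at u i n) q -> size q <= K.
Proof.
set w := factor_at u i n => gap [[j]]; rewrite size_cat size_factor_at => Ej.
move=> [/prefixP[x Ex] [_ c2]]; rewrite leqNgt; apply/negP=> lt_Kq.
(* Starting at [j.+1] avoids the initial occurrence, and [K < size q] keeps [t] before the final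
   one: a third occurrence. *)
have [t le_t Et] := gap j.+1.
have Eq : w = factor_at u (j + size q) n.
  move/eqP: Ej; rewrite factor_at_cat eqseq_cat ?size_factor_at //.
  by case/andP=> _ /eqP.
have E0 : factor_at u j n = w.
  move/eqP: Ej; rewrite addnC factor_at_cat Ex eqseq_cat ?size_factor_at //.
  by case/andP=> /eqP.
move: c2; rewrite -Ej Eq count_occ_factor_at -Eq => c2.
suff : 3 <= 2 by [].
rewrite -{2}c2 -size_filter.
apply: (@uniq_leq_size _ [:: 0; t - j; size q]).
  by rewrite /= !inE; lia.
move=> s; rewrite mem_filter mem_iota !inE => /or3P[]/eqP->.
- by rewrite addn0 E0 eqxx.
- by rewrite subnKC ?Et ?eqxx; lia.
- by rewrite -Eq eqxx; lia.
Qed.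

End InfiniteWords.

(** Return words have length at most [K], and a finite alphabet has finitely many such words. *)
Lemma uniformly_recurrent_of_bounded_gaps (A : finType) (u : nat -> A) :
  bounded_gaps u -> uniformly_recurrent u.
Proof.
move=> gap; split=> [i n N|w [i Ew]].
  have [K gapK] := gap i n; have [t /andP[le_Nt _] Et] := gapK N.
  by exists t.
have [K gapK] := gap i (size w).
exists (map val (enum {: {bseq K of A}})) => q retq.
have le_qK : size q <= K by apply: return_word_bounded gapK _; rewrite Ew.
by rewrite -[q]/(val (Bseq le_qK)) map_f ?mem_enum.
Qed.

(** * Complete returns in infinite words of finite defect *)

Section AlmostRich.
Variables (A : choiceType) (Th : seq A -> seq A) (u : nat -> A).
Hypotheses (ThP : involutive_antimorphism Th) (finD : finite_defect Th u).

(** Defects are integers bounded by [D], so the maximum is attained: induction on the room [e] left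
    below [D]. *)
Lemma max_defect : exists i n, forall j k,
  (defect Th (factor_at u j k) <= defect Th (factor_at u i n))%R.
Proof.
have [D leD] := finD.
suff H (e : nat) i n : (D - defect Th (factor_at u i n) <= e%:Z)%R ->
    exists i n, forall j k,
      (defect Th (factor_at u j k) <= defect Th (factor_at u i n))%R.
  apply: (H `|(D - defect Th (factor_at u 0 0))%R|%N 0 0).
  by have := leD 0 0; lia.
elim: e i n => [|e IH] i n le.
  by exists i, n => j k; have := leD j k; lia.
case: (classic (exists j k,
    (defect Th (factor_at u i n) < defect Th (factor_at u j k))%R)).
  by case=> j [k lt]; apply: (IH j k); lia.
move=> no; exists i, n => j k; rewrite Order.TotalTheory.leNgt; apply/negP=> lt.
by apply: no; exists j, k.
Qed.

Definition occurs_upto_Th n i t :=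
  (factor_at u t n == factor_at u i n) || (factor_at u t n == Th (factor_at u i n)).

(** Naming z by its position [i] treats z and [Th z] alike: as [Th] is an involution, both define
    the same set of occurrences. *)
Definition complete_returns_pal H := forall i n j,
  H <= n -> i < j -> occurs_upto_Th n i j ->
  (forall t, i < t < j -> ~~ occurs_upto_Th n i t) ->
  Th (factor_at u i (j - i + n)) = factor_at u i (j - i + n).

(* Any factor containing one of maximal defect has itself maximal defect. *)
Lemma long_complete_returns_pal :
  bounded_gaps u -> exists H, complete_returns_pal H.
Proof.
move=> gap; have [i0 [n0 maxD]] := max_defect; have [K gapK] := gap i0 n0.
(* Every window of length [K + n0] contains the factor of maximal defect; the successor makes z
   visibly nonempty. *)
exists (K + n0).+1 => i n j le_n lt_ij occj noocc.
have Eij : i + (j - i) = j by lia.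
apply: (complete_return_pal ThP (z := factor_at u i n)).
- by rewrite !size_factor_at; lia.
- by rewrite addnC factor_at_cat prefix_prefix.
- by rewrite factor_at_cat Eij; case/orP: occj => /eqP <-; rewrite suffix_suffix ?orbT.
- move=> s x t xP Eq; have sx : size x = n.
    by case/orP: xP => /eqP->; rewrite ?(size_Th ThP) size_factor_at.
  have := congr1 size Eq; rewrite size_factor_at !size_cat sx => sq.
  have le : size s + n <= j - i + n by lia.
  move/eqP: Eq; rewrite (factor_at_split u i le) eqseq_cat ?size_factor_at //.
  rewrite eqseq_cat ?size_factor_at // => /and3P[_ /eqP Ex _].
  case: (posnP (size s)) => [/size0nil->|s0]; first by left.
  case: (posnP (size t)) => [/size0nil->|t0]; first by right.
  have /noocc : i < i + size s < j by lia.
  by rewrite /occurs_upto_Th Ex xP.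
- have [t le_t Et] := gapK i.
  have : (defect Th (factor_at u i0 n0) <= defect Th (factor_at u i n))%R.
    rewrite -Et; apply: (defect_infix ThP).
    have -> : t = i + (t - i) by lia.
    by apply: infix_factor_at; lia.
  by have := maxD i (j - i + n); lia.
Qed.

End AlmostRich.

(** * Left extension within the language of a recurrent word *)

Lemma left_extension (A : finType) (u : nat -> A) n : recurrent u ->
  exists U : nat -> A, (forall k, U (n + k) = u k) /\
    (forall i m, exists j, factor_at U i m = factor_at u j m).
Proof.
move=> rec.
(* Compactness: if each of the finitely many [x] failed at some length [f x], take the maximum [N]
   of these. The prefix of length [N] recurs at some [j >= n], and the [n] letters before it form an
   [x] that does not fail. *)
have [x xP] : exists x : n.-tuple A, forall N, exists j, factor_at u j (n + N) = x ++ factor_at u 0 N.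
  apply: NNPP => no.
  have : forall x : n.-tuple A, exists N, forall j,
      factor_at u j (n + N) <> x ++ factor_at u 0 N.
    move=> x; apply: NNPP => h; apply: no; exists x => N; apply: NNPP => h'.
    by apply: h; exists N => j Ej; apply: h'; exists j.
  case/fin_all_exists=> f fP; pose N := \max_x f x.
  have [j [le_nj Ej]] := rec 0 N n.
  have sx : size (factor_at u (j - n) n) == n by rewrite size_factor_at.
  apply: (fP (Tuple sx) (j - n)) => /=.
  rewrite factor_at_cat; congr (_ ++ _).
  have -> : j - n + n = j by lia.
  have le : f (Tuple sx) <= N := leq_bigmax _.
  by have := sub_factor_at (d := 0) Ej le; rewrite !addn0.
(* The default [u 0] is never read. Each factor of [U] lies in some [x ++ factor_at u 0 N], hence
   occurs in [u]. *)
pose U k := if k < n then nth (u 0) x k else u (k - n).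
exists U; split=> [k|i m].
  by rewrite /U ltnNge leq_addr /= addKn.
have [j Ej] := xP (i + m).
exists (j + i); apply/factor_atP => d lt_dm; rewrite -addnA.
have := congr1 (fun s => nth (u 0) s (i + d)) Ej.
rewrite nth_mkseq; last by lia.
move=> ->; rewrite nth_cat size_tuple /U; case: ltnP => // le_n.
by rewrite nth_mkseq //; lia.
Qed.

Lemma bounded_gaps_left_extension (A : choiceType) (u U : nat -> A) n :
  (forall k, U (n + k) = u k) ->
  (forall i m, exists j, factor_at U i m = factor_at u j m) ->
  bounded_gaps u -> bounded_gaps U.
Proof.
move=> UE Uf gap i m; have [j ->] := Uf i m; have [K gapK] := gap j m.
(* Occurrences found in [u] are shifted by the [n] added letters. *)
exists (n + K) => k; have [t le_t <-] := gapK k.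
exists (n + t); first by lia.
by apply/factor_atP=> d _; rewrite -addnA UE.
Qed.

(** * Marked positions and the coding word *)

Lemma enumerate_marks (P : pred nat) K :
  P 0 -> (forall j, exists2 t, j <= t < j + K & P t) ->
  exists m : nat -> nat, m 0 = 0 /\ forall i,
    [/\ P (m i), m i < m i.+1 <= m i + K & forall t, m i < t < m i.+1 -> ~~ P t].
Proof.
move=> P0 gap.
have ex t : exists s, (t < s) && P s.
  by have [s le_s Ps] := gap t.+1; exists s; rewrite Ps andbT; lia.
pose nxt t := ex_minn (ex t); pose m := fix m i := if i is i'.+1 then nxt (m i') else 0.
exists m; split=> // i; split.
- by case: i => //= i; rewrite /nxt; case: ex_minnP => s /andP[].
- rewrite /= /nxt; case: ex_minnP => s /andP[-> _] min_s /=.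
  have [t /andP[lt_mt lt_t] Pt] := gap (m i).+1.
  by have := min_s t; rewrite lt_mt Pt => /(_ isT); lia.
- move=> t; rewrite /= /nxt; case: ex_minnP => s _ min_s /andP[lt_mt lt_ts].
  by apply/negP=> Pt; have := min_s t; rewrite lt_mt Pt => /(_ isT); lia.
Qed.

(* [m] enumerates the positions at which the prefix of [U] of length [L], or its
   image by [Th], occurs; [v] codes [U] by the words between consecutive such
   positions, each taken together with the occurrence that ends it. *)
Section Coding.
Variables (A B : choiceType) (Th : seq A -> seq A) (U : nat -> A) (L : nat).
Variables (m : nat -> nat) (v : nat -> B).
Hypotheses (ThP : involutive_antimorphism Th) (retP : complete_returns_pal Th U L).
Let mark := occurs_upto_Th Th U L 0.
Hypotheses (m0 : m 0 = 0) (m_lt : forall i, m i < m i.+1).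
Hypotheses (mark_m : forall i, mark (m i)).
Hypothesis m_gap : forall i t, m i < t < m i.+1 -> ~~ mark t.

Definition block i := factor_at U (m i) (m i.+1 - m i + L).

Hypothesis vP : forall i j, v i = v j <-> block i = block j.

Lemma leq_m : {mono m : i j / i <= j}.
Proof. exact: leq_mono (homo_ltn ltn_trans m_lt). Qed.

Lemma ltn_m : {mono m : i j / i < j}.
Proof. exact: leqW_mono leq_m. Qed.

Lemma mark_next i t :
  mark t -> m i < t -> (forall s, m i < s < t -> ~~ mark s) -> t = m i.+1.
Proof.
move=> mt lt_mt not_mark; case: (ltngtP t (m i.+1)) => // lt.
  by have := m_gap (i := i) (t := t); rewrite lt_mt lt mt => /(_ isT).
by have := not_mark (m i.+1); rewrite m_lt lt mark_m => /(_ isT).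
Qed.

Lemma mark_index t : mark t -> exists i, t = m i.
Proof.
move=> mt; suff [i /andP[le lt]] : exists i, m i <= t < m i.+1.
  exists i; move: le; rewrite leq_eqVlt => /orP[/eqP->//|lt'].
  by have := m_gap (i := i) (t := t); rewrite lt lt' mt => /(_ isT).
elim: t {mt} => [|t [i le]]; first by exists 0; have := m_lt 0; lia.
case: (ltnP t.+1 (m i.+1)) => h; first by exists i; lia.
by exists i.+1; have := m_lt i.+1; lia.
Qed.

Lemma mark_eq s t : factor_at U s L = factor_at U t L -> mark s = mark t.
Proof. by rewrite /mark /occurs_upto_Th => ->. Qed.

Lemma mark_Th s t : Th (factor_at U s L) = factor_at U t L -> mark s = mark t.
Proof.
rewrite /mark /occurs_upto_Th => <-.
by rewrite (inj_eq (Th_inj ThP)) (can2_eq (ThK ThP) (ThK ThP)) orbC.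
Qed.

(** A block is a complete return whether it starts with the prefix of [U] or with its image: the
    marks are the same. *)
Lemma block_pal i : Th (block i) = block i.
Proof.
have occE t : occurs_upto_Th Th U L (m i) t = mark t.
  have := mark_m i; rewrite /mark /occurs_upto_Th => /orP[]/eqP-> //.
  by rewrite (ThK ThP) orbC.
apply: retP; [exact: leqnn | exact: m_lt | by rewrite occE |].
by move=> t; rewrite occE; apply: m_gap.
Qed.

(** At least one letter is required: an empty code leaves [L] letters of [U], which may be the
    prefix or its image. *)
Lemma eq_code_word a b l :
  factor_at v a l.+1 = factor_at v b l.+1 ->
  m (a + l.+1) - m a = m (b + l.+1) - m b /\
  factor_at U (m a) (m (a + l.+1) - m a + L) =
  factor_at U (m b) (m (a + l.+1) - m a + L).
Proof.
elim: l => [|l IH] /factor_atP Ev.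
  have := Ev 0 isT; rewrite !addn0 !addn1 => /vP E.
  have E2 := congr1 size E; rewrite !size_factor_at in E2.
  by split; [lia | rewrite [in RHS]E2; exact: E].
have [E1 E2] : m (a + l.+1) - m a = m (b + l.+1) - m b /\
    factor_at U (m a) (m (a + l.+1) - m a + L) =
    factor_at U (m b) (m (a + l.+1) - m a + L).
  by apply/IH/factor_atP=> d lt; apply: Ev; lia.
have /vP E3 := Ev l.+1 (leqnn _).
have E4 := congr1 size E3; rewrite !size_factor_at in E4.
have := m_lt (a + l.+1); have := m_lt (b + l.+1); rewrite -!addnS => ltb lta.
rewrite -!addnS in E4.
have mla : m a <= m (a + l.+1) by rewrite leq_m; lia.
have mlb : m b <= m (b + l.+1) by rewrite leq_m; lia.
split; first by lia.
move: E3; rewrite /block -!addnS E4 => /factor_atP E3.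
move/factor_atP: E2 => E2.
apply/factor_atP=> d lt_d; case: (ltnP d (m (a + l.+1) - m a)) => h.
  by apply: E2; lia.
have := E3 (d - (m (a + l.+1) - m a)).
have -> : m (a + l.+1) + (d - (m (a + l.+1) - m a)) = m a + d by lia.
have -> : m (b + l.+1) + (d - (m (a + l.+1) - m a)) = m b + d by lia.
by apply; lia.
Qed.

(** Whether a position is a mark is decided by the [L] letters read there, so equal words carry
    equal marks and the next mark falls at the same distance. *)
Lemma eq_block_word a b :
  factor_at U (m a) (m a.+1 - m a + L) = factor_at U (m b) (m a.+1 - m a + L) ->
  m b.+1 - m b = m a.+1 - m a /\ v a = v b.
Proof.
move=> E; have markE d : d <= m a.+1 - m a -> mark (m a + d) = mark (m b + d).
  by move=> le; apply/mark_eq/(sub_factor_at E); lia.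
have lta := m_lt a; have Eb : m b + (m a.+1 - m a) = m b.+1.
  apply: mark_next; [|by lia|].
    by rewrite -markE // subnKC ?mark_m; lia.
  move=> s lt_s; have -> : s = m b + (s - m b) by lia.
  by rewrite -markE; [apply: m_gap; instantiate (1 := a) |]; lia.
have E' : m b.+1 - m b = m a.+1 - m a by lia.
by split=> //; apply/vP; rewrite /block E' E.
Qed.

Lemma eq_word_code a b l :
  factor_at U (m a) (m (a + l) - m a + L) =
  factor_at U (m b) (m (a + l) - m a + L) ->
  m (b + l) - m b = m (a + l) - m a /\ factor_at v a l = factor_at v b l.
Proof.
elim: l => [|l IH] E; first by rewrite !addn0 !subnn.
have lta := m_lt (a + l).
have mla : m a <= m (a + l) by rewrite leq_m; lia.
have mlb : m b <= m (b + l) by rewrite leq_m; lia.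
rewrite !addnS in E *.
have [E1 E2] : m (b + l) - m b = m (a + l) - m a /\ factor_at v a l = factor_at v b l.
  apply: IH; have := sub_factor_at (d := 0) (k := m (a + l) - m a + L) E.
  by rewrite !addn0; apply; lia.
have [E3 E4] : m (b + l).+1 - m (b + l) = m (a + l).+1 - m (a + l) /\ v (a + l) = v (b + l).
  apply: eq_block_word.
  have := sub_factor_at (d := m (a + l) - m a) (k := m (a + l).+1 - m (a + l) + L) E.
  by rewrite subnKC // -E1 subnKC //; apply; lia.
have ltb := m_lt (b + l).
by split; [lia | rewrite !factor_at_rcons E2 E4].
Qed.

(** Mirroring a palindrome of [U] permutes its marks, hence sends each block to the symmetric one;
    blocks being palindromes, the two are equal. *)
Lemma pal_word_code a l :
  Th (factor_at U (m a) (m (a + l) - m a + L)) =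
    factor_at U (m a) (m (a + l) - m a + L) ->
  rev (factor_at v a l) = factor_at v a l.
Proof.
move=> QP; have mla : m a <= m (a + l) by rewrite leq_m; lia.
have markE d : d <= m (a + l) - m a -> mark (m a + d) = mark (m (a + l) - d).
  move=> le; apply: mark_Th; rewrite (pal_slice ThP QP); last by lia.
  by congr factor_at; lia.
(* The reflection of the next mark from the right end is the next mark from the left end. *)
have mirror i : i <= l -> m (a + i) + m (a + l - i) = m a + m (a + l).
  elim: i => [|i IH] le_il; first by rewrite addn0 subn0.
  have [k Ek] : exists k, a + l - i = k.+1 /\ a <= k by exists (a + l - i).-1; lia.
  have {IH} := IH (ltnW le_il); case: Ek => Ek le_ak.
  have -> : a + l - i.+1 = k by lia.
  rewrite Ek addnS => E.
  have ltk := m_lt k.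
  have mak : m a <= m k by rewrite leq_m.
  have mai : m a <= m (a + i) by rewrite leq_m; lia.
  have mkl : m k.+1 <= m (a + l) by rewrite leq_m; lia.
  suff : m a + (m (a + l) - m k) = m (a + i).+1 by lia.
  apply: mark_next; [|by lia|].
    by rewrite markE; last lia; rewrite (_ : _ - _ = m k) ?mark_m //; lia.
  move=> s lt_s; have -> : s = m a + (s - m a) by lia.
  by rewrite markE; [apply: m_gap; instantiate (1 := k)|]; lia.
have Ev i : i < l -> v (a + i) = v (a + (l - i.+1)).
  move=> lt_il; apply/vP; rewrite -[RHS]block_pal /block.
  have e1 := mirror i (ltnW lt_il); have e2 := mirror i.+1 lt_il.
  have E3 : a + l - i.+1 = a + (l - i.+1) by lia.
  have E4 : a + l - i = (a + (l - i.+1)).+1 by lia.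
  rewrite E3 addnS in e2; rewrite E4 in e1.
  have lt1 := m_lt (a + i); have lt2 := m_lt (a + (l - i.+1)).
  set k := a + (l - i.+1) in e1 e2 lt2 *.
  have mk : m a <= m k by rewrite leq_m /k; lia.
  have mi : m (a + i).+1 <= m (a + l) by rewrite leq_m; lia.
  have mi' : m a <= m (a + i) by rewrite leq_m; lia.
  have -> : m k = m a + (m k - m a) by lia.
  by rewrite (pal_slice ThP QP); [congr factor_at; lia | lia].
apply: (@eq_from_nth _ (v 0)); first by rewrite size_rev.
move=> i; rewrite size_rev size_factor_at => lt_il.
rewrite nth_rev ?size_factor_at // !nth_mkseq //; last by lia.
exact/esym/Ev.
Qed.

(** Every occurrence in [U] of the coded word starts at a mark. Since [m] grows by at least one at
    each step, the gap bound [K] of [U] also bounds the gaps in indices. *)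
Lemma bounded_gaps_code : bounded_gaps U -> bounded_gaps v.
Proof.
move=> gap a l; have [K gapK] := gap (m a) (m (a + l) - m a + L).
exists K => i; have [t le_t Et] := gapK (m i).
have /mark_index[b Eb] : mark t.
  rewrite (@mark_eq t (m a)) ?mark_m //.
  have := sub_factor_at (d := 0) (k := L) Et; rewrite !addn0; apply; lia.
rewrite {t}Eb in le_t Et; exists b; last by have [_ ->] := eq_word_code (esym Et).
have le_ib : i <= b by rewrite -leq_m; lia.
have : b - i <= m b - m i; last by lia.
have -> : b = i + (b - i) by lia.
elim: (b - i) => [|d IH]; first by rewrite addn0 subnn.
have := m_lt (i + d); have : m i <= m (i + d) by rewrite leq_m; lia.
by rewrite addKn in IH; rewrite addKn addnS; lia.
Qed.

(** * Richness of the coding word *)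

Lemma rev_antimorphism : involutive_antimorphism (@rev B).
Proof. by split; [exact: revK | exact: rev_cat]. Qed.

(* Among the palindromes [U[m j .. m e + L[] take the longest, with code [s].
   If [s] occurred earlier in [v[i .. e[], the complete return to that
   palindrome would be a longer palindrome of the same form. *)
Lemma nPal_code_rcons i k :
  nPal (@rev B) (factor_at v i k) < nPal (@rev B) (factor_at v i k.+1).
Proof.
set e := i + k.+1; have Ee : e = (i + k).+1 by rewrite /e addnS.
pose S j := factor_at U (m j) (m e - m j + L).
have exP : exists j, (i <= j < e) && (Th (S j) == S j).
  exists (i + k); rewrite /S Ee (block_pal (i + k)) eqxx; lia.
case: (ex_minnP exP) => j /andP[/andP[le_ij lt_je] /eqP SP] min_j.
have Eje : j + (e - j) = e by lia.
have sP : rev (factor_at v j (e - j)) = factor_at v j (e - j).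
  by apply: pal_word_code; rewrite Eje.
rewrite factor_at_rcons; apply: (nPal_rcons_new sP); rewrite -?factor_at_rcons.
  have -> : j = i + (j - i) by lia.
  by apply: infix_factor_at; lia.
apply/negP=> /infix_factor_atP[d]; rewrite size_factor_at => le_dk.
have [l El] : exists l, e - j = l.+1 by exists (e - j).-1; lia.
rewrite El => /eq_code_word[E1 E2].
rewrite -El Eje in E1; rewrite -El E1 -/(S j) in E2.
have lt_mj : m (i + d) < m j by rewrite ltn_m; lia.
pose N := m e - m j + L.
(* Keeping [t] at or after [m i] makes the longer palindrome start at an index from [i] on, against
   the minimality of [j]. *)
have exQ : exists t, (m i <= t < m j) && (factor_at U t N == S j).
  by exists (m (i + d)); rewrite /N E2 eqxx lt_mj leq_m; lia.
have ubQ t : (m i <= t < m j) && (factor_at U t N == S j) -> t <= m j by lia.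
case: (ex_maxnP exQ ubQ) => t /andP[/andP[le_it lt_tj] /eqP Et] max_t.
have QP : Th (factor_at U t (m j - t + N)) = factor_at U t (m j - t + N).
  apply: retP => //; rewrite /occurs_upto_Th ?Et; first by rewrite /N leq_addl.
    by rewrite eqxx.
  move=> s /andP[lt_ts lt_sj]; rewrite SP orbb; apply/negP=> Es.
  have : s <= t by apply: max_t; rewrite Es andbT; lia.
  by lia.
have /mark_index[b Eb] : mark t.
  rewrite (@mark_eq t (m j)) ?mark_m //.
  by have := sub_factor_at (d := 0) (k := L) Et; rewrite !addn0; apply; rewrite /N; lia.
move: le_it lt_tj; rewrite Eb leq_m ltn_m => le_ib lt_bj.
have : j <= b; last by lia.
apply: min_j; rewrite le_ib /=; apply/andP; split; first by lia.
have mbj : m b < m j by rewrite ltn_m.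
have mje : m j < m e by rewrite ltn_m.
apply/eqP; move: QP; rewrite Eb /S (_ : m j - m b + N = m e - m b + L) //.
by rewrite /N; lia.
Qed.

(** Reversal fixes letters, so no pairs are counted. From defect 0 of the empty word, a new
    palindrome per letter keeps the defect from rising and monotonicity keeps it from falling. *)
Lemma rich_code : rich_inf (@rev B) v.
Proof.
move=> i; rewrite /rich.
have G0 w : G_Th (@rev B) w = 0.
  by rewrite /G_Th (eq_filter (a2 := pred0)) ?filter_pred0 // => b; rewrite /= eqxx.
have defectE k : defect (@rev B) (factor_at v i k) =
    (k.+1%:Z - (nPal (@rev B) (factor_at v i k))%:Z)%R.
  by rewrite /defect G0 size_factor_at; lia.
elim=> [|k IH]; first by rewrite /defect G0.
have := defect_rcons rev_antimorphism (factor_at v i k) (v (i + k)).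
rewrite -factor_at_rcons IH; have := nPal_code_rcons i k.
by rewrite !defectE in IH *; lia.
Qed.

End Coding.

(** * Transfer of the return property and construction of the morphism *)

Lemma complete_returns_pal_factors (A : choiceType) (Th : seq A -> seq A)
    (u U : nat -> A) H L :
  (forall i m, exists j, factor_at U i m = factor_at u j m) -> H <= L ->
  complete_returns_pal Th u H -> complete_returns_pal Th U L.
Proof.
move=> Uf le_HL retP i n j le_Ln lt_ij occj noocc.
(* Only the factor of [U] read at [i] is involved; it occurs in [u] at [k], and positions are
   shifted accordingly. *)
have [k Ek] := Uf i (j - i + n).
have occE t : i <= t <= j -> occurs_upto_Th Th U n i t = occurs_upto_Th Th u n k (k + (t - i)).
  move=> le_t; rewrite /occurs_upto_Th.
  have <- : factor_at U (i + (t - i)) n = factor_at u (k + (t - i)) n.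
    by apply: (sub_factor_at Ek); lia.
  have := sub_factor_at (d := 0) (k := n) Ek; rewrite !addn0 => <-; last by lia.
  by rewrite subnKC //; lia.
rewrite Ek; have Ekj : k + (j - i) - k = j - i by lia.
rewrite -Ekj; apply: retP; [by lia|by lia| |].
  by rewrite -occE //; lia.
move=> t lt_t; have -> : t = k + (i + (t - k) - i) by lia.
by rewrite -occE; [apply: noocc|]; lia.
Qed.

Theorem theorem2 (A : finType) (Th : seq A -> seq A) (u : nat -> A) :
  involutive_antimorphism Th ->
  uniformly_recurrent u ->
  finite_defect Th u ->
  exists (B : finType) (phi : B -> seq A) (v : nat -> B),
    uniformly_recurrent v /\ morph_image phi v u /\ rich_inf (@rev B) v.
Proof.
move=> ThP uP finD; have gap_u := bounded_gaps_of_uniformly_recurrent uP.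
have [n ret_u] := long_complete_returns_pal ThP finD gap_u.
(* With [L = n + n], the centre of the first mark is position [n] of [U], exactly where [u]
   begins. *)
have [U [UE Uf]] := left_extension n uP.1; pose L := n + n.
have gap_U := bounded_gaps_left_extension UE Uf gap_u.
have ret_U := complete_returns_pal_factors Uf (leq_addr n n : n <= L) ret_u.
pose mark := occurs_upto_Th Th U L 0.
have [K gapK] := gap_U 0 L.
have [||m [m0 mP]] := @enumerate_marks mark K _ _.
- by rewrite /mark /occurs_upto_Th eqxx.
- move=> j; have [t le_t Et] := gapK j; exists t => //.
  by rewrite /mark /occurs_upto_Th Et eqxx.
have m_lt i : m i < m i.+1 by case: (mP i) => _ /andP[].
have m_le i : m i.+1 <= m i + K by case: (mP i) => _ /andP[].
have mark_m i : mark (m i) by case: (mP i).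
have m_gap i t : m i < t < m i.+1 -> ~~ mark t by case: (mP i) => _ _; apply.
(* Gaps between marks are at most [K], so blocks fit in length [K + L]: the alphabet is finite and
   the default of [insub_bseq] is never taken. *)
pose v i : {bseq (K + L) of A} := insub_bseq (K + L) (block U L m i).
have valv i : v i = block U L m i :> seq A.
  rewrite /= /insub_bseq insubdK // unfold_in size_factor_at.
  by have := m_le i; lia.
have vP i j : v i = v j <-> block U L m i = block U L m j.
  by rewrite -!valv; split=> [->//|]; apply: val_inj.
(* This keeps the part of a block between the centres of its initial and final occurrences. *)
pose phi (q : {bseq (K + L) of A}) := take (size q - L) (drop n q).
have phiv i : phi (v i) = factor_at u (m i) (m i.+1 - m i).
  rewrite /phi valv /block size_factor_at addnK.
  have le : n + (m i.+1 - m i) <= m i.+1 - m i + L by rewrite /L; lia.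
  rewrite (factor_at_split U (m i) le) drop_size_cat ?take_size_cat ?size_factor_at //.
  by apply/factor_atP=> d _; rewrite -UE; congr U; lia.
have word_v k : morph_word phi (mkseq v k) = factor_at u 0 (m k).
  elim: k => [|k IH]; first by rewrite m0.
  rewrite /morph_word mkseqS map_rcons flatten_rcons -/(morph_word _ _) IH phiv.
  by rewrite -factor_at_cat subnKC // ltnW.
exists {bseq (K + L) of A}, phi, v; split; last split.
- apply: uniformly_recurrent_of_bounded_gaps.
  exact: (bounded_gaps_code m0 m_lt mark_m m_gap vP gap_U).
- split=> k; rewrite ?word_v ?size_factor_at //; exists k.
  rewrite word_v size_factor_at; elim: k => [|k IH] //.
  exact: leq_ltn_trans IH (m_lt k).
- exact: (rich_code ThP ret_U m0 m_lt mark_m m_gap vP).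
Qed.
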